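(* Let $\mathcal{H}$ be a complex Hilbert space, let $X$ be the manifold of rank-$n$ idempotents of $\mathcal{H}$ (identified with $\mathrm{T}^*\mathbf{G}\mathcal{H}$), and let $J,\hat J$ be the almost complex structures on $X$ defined in the context. Then $[J,\hat{J}]=0$, i.e. $J\hat J=\hat J J$.
   Context: $\mathcal{B}(\mathcal{H})$ denotes the bounded operators and $[A,B]=AB-BA$. $X=\{q\in\mathcal{B}(\mathcal{H}): q^2=q,\ \mathrm{Tr}(q)=n\}$, with $\mathrm{T}_qX=\{A\in\mathcal{B}(\mathcal{H}): qA+Aq=A\}$. $\mathbf{G}\mathcal{H}\subset X$ is the Grassmannian of $n$-dimensional subspaces, identified with the Hermitian idempotents in $X$; $\mathrm{T}_p\mathbf{G}\mathcal{H}=\{A=A^*: pA+Ap=A\}$. The map $\pi:X\to\mathbf{G}\mathcal{H}$ sends $q$ to the orthogonal projection onto the image of $q$; $X$ with $\pi$ is identified with the bundle $\mathrm{T}^*\mathbf{G}\mathcal{H}$, the fibers of $\pi$ being complex vector spaces with operations $r\cdot q=(1-r)\pi(q)+rq$ ($r\in\mathbb{C}$) and $q\oplus q'=q+q'-\pi(q)$. The almost complex structure $J$ on $X$ is $JA=i[A,q]$ for $A\in \mathrm{T}_qX$; it restricts to a complex structure on $\mathbf{G}\mathcal{H}$, also denoted $J$. Consider the connection on $\pi:X\to\mathbf{G}\mathcal{H}$ given by the horizontal lifts $$H_q:\mathrm{T}_{\pi(q)}\mathbf{G}\mathcal{H}\to \mathrm{T}_qX,\qquad H_q(A)=[q,[\pi(q),A]].$$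 $\hat J$ is the almost complex structure on $X$ determined by this connection: on vertical vectors ($\ker\pi_*$) it is the complex structure of the fibers, $\hat JA=iA$, and on horizontal vectors it is the lift of $J$ on the base, $\hat J H_q(A)=H_q(JA)$ for $A\in \mathrm{T}_{\pi(q)}\mathbf{G}\mathcal{H}$. *)

(* Defs.v *)
From HB Require Import structures.
From mathcomp Require Import all_boot all_order all_algebra.
From mathcomp Require Import complex sesquilinear.
From mathcomp Require Import all_classical all_reals all_analysis.

Set Implicit Arguments.
Unset Strict Implicit.
Unset Printing Implicit Defensive.

Import Order.TTheory GRing.Theory Num.Theory.
Import numFieldNormedType.Exports.

Local Open Scope ring_scope.
Local Open Scope classical_set_scope.
Local Open Scope complex_scope.

Section BoundedOperators.
Variables (K : numFieldType) (V : normedModType K).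

Definition bounded_op : {pred V -> V} :=
  fun f => `[< linear f /\ continuous f >].

Lemma bounded_opP f : reflect (linear f /\ continuous f) (f \in bounded_op).
Proof. exact: asboolP. Qed.

Record BH := MkBH { BH_val :> V -> V ; BH_valP : BH_val \in bounded_op }.

HB.instance Definition _ := [isSub of BH for BH_val].
HB.instance Definition _ := [Choice of BH by <:].

Lemma bounded_op_submod : submod_closed bounded_op.
Proof.
split.
  apply/bounded_opP; split=> [a x y|x]; first by rewrite scaler0 addr0.
  exact: cst_continuous.
move=> a f g /bounded_opP[lf cf] /bounded_opP[lg cg]; apply/bounded_opP; split.
  move=> b x y; rewrite !fctE lf lg !scalerDr !scalerA (mulrC a b).
  by rewrite addrACA.
move=> x; apply: cvgD; last exact: cg.
by apply: cvgZr; exact: cf.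
Qed.

HB.instance Definition _ :=
  GRing.isSubmodClosed.Build K (V -> V) bounded_op bounded_op_submod.
HB.instance Definition _ := [SubChoice_isSubLmodule of BH by <:].

Lemma BH_ext (A B : BH) : (forall x, A x = B x) -> A = B.
Proof. by move=> AB; apply/val_inj/funext. Qed.

Lemma BH_linear (A : BH) : linear A.
Proof. by case/bounded_opP: (BH_valP A). Qed.

HB.instance Definition _ (A : BH) :=
  GRing.isLinear.Build K V V *:%R (BH_val A) (BH_linear A).

Lemma BH_continuous (A : BH) : continuous A.
Proof. by case/bounded_opP: (BH_valP A). Qed.

Fact BH_one_subproof : idfun \in bounded_op.
Proof. by apply/bounded_opP; split=> // x; exact: cvg_id. Qed.
Definition BH_one := MkBH BH_one_subproof.

Fact BH_mul_subproof (A B : BH) : A \o B \in bounded_op.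
Proof.
apply/bounded_opP; split=> [a x y|x] /=; first by rewrite !linearP.
by apply: continuous_comp; exact: BH_continuous.
Qed.
Definition BH_mul (A B : BH) := MkBH (BH_mul_subproof A B).

Fact BH_mulA : associative BH_mul.
Proof. by move=> A B C; exact: BH_ext. Qed.
Fact BH_mul1 : left_id BH_one BH_mul.
Proof. by move=> A; exact: BH_ext. Qed.
Fact BH_mulr1 : right_id BH_one BH_mul.
Proof. by move=> A; exact: BH_ext. Qed.
Fact BH_mulDl : left_distributive BH_mul +%R.
Proof. by move=> A B C; exact: BH_ext. Qed.
Fact BH_mulDr : right_distributive BH_mul +%R.
Proof. by move=> A B C; apply: BH_ext => x; rewrite /= raddfD. Qed.

HB.instance Definition _ := GRing.Zmodule_isPzRing.Build BH
  BH_mulA BH_mul1 BH_mulr1 BH_mulDl BH_mulDr.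

Fact BH_scaleAl (a : K) (A B : BH) : a *: (A * B) = (a *: A) * B.
Proof. exact: BH_ext. Qed.
Fact BH_scaleAr (a : K) (A B : BH) : a *: (A * B) = A * (a *: B).
Proof. by apply: BH_ext => x; rewrite [RHS]/= linearZ. Qed.

(* [opnorm_le A M] says that the operator norm of [A] is at most [M]. *)
Definition opnorm_le (A : BH) (M : K) := forall x, `|A x| <= M * `|x|.

Definition bracket (A B : BH) : BH := A * B - B * A.

End BoundedOperators.

Arguments BH {K} V.

(* The Hilbert space is a complete normed space [H] over [R[i]] with a positive
   definite Hermitian form [ip], linear in its first argument; that [ip] induces
   the norm of [H] is [ip_norm].  Operators act on the whole of [H], so [BH H] is
   the algebra of bounded operators, with composition as product. *)
Section Idempotents.
Variables (R : realType) (H : completeNormedModType R[i]).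
Variable ip : {dot H for Num.conj}.

Definition ip_norm := forall x, `|x| ^+ 2 = ip x x.

Definition hermitian_op (A : BH H) := forall x y, ip (A x) y = ip x (A y).

(* [A] is trace class with trace [t].  Trace class is expressed by a nuclear
   representation [A x = \sum_k <x, u k> v k] with
   [\sum_k `|u k| * `|v k| < +oo], and then [Tr A = \sum_k <v k, u k>], which does
   not depend on the representation.  Sequences suffice even if [H] is not
   separable, since a trace class operator has separable range and corange. *)
Definition has_trace (A : BH H) (t : R[i]) := exists u v : nat -> H,
  [/\ cvgn (series (fun k => `|u k| * `|v k| : R[i]^o)),
      forall x, series (fun k => ip x (u k) *: v k) @ \oo --> A x
    & series (fun k => ip (v k) (u k) : R[i]^o) @ \oo --> (t : R[i]^o)].

Definition X (n : nat) (q : BH H) := q * q = q /\ has_trace q n%:R.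

Definition TX (q A : BH H) := q * A + A * q = A.

Definition TG (p A : BH H) := hermitian_op A /\ p * A + A * p = A.

Definition is_orthoproj_onto (S : set H) (p : BH H) :=
  [/\ p * p = p, hermitian_op p & range p = S].

(* The default value [0] is never used on idempotents: the range of a bounded
   idempotent is closed, hence has a unique orthogonal projection. *)
Definition piX (q : BH H) : BH H := xget 0 (is_orthoproj_onto (range q)).

(* The real curve [c] has derivative [A] at [0], in operator norm. *)
Definition velocity (c : R -> BH H) (A : BH H) := forall e : R, 0 < e ->
  \forall t \near (0 : R)^', opnorm_le ((t^-1)%:C *: (c t - c 0) - A) e%:C.

(* [pi_*] at [q] sends [A] to [B], computed along a curve in [X n] through [q]
   with velocity [A]. *)
Definition pushforward (n : nat) (q A B : BH H) := exists c : R -> BH H,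
  [/\ forall t, X n (c t), c 0 = q, velocity c A & velocity (piX \o c) B].

Definition vertical (n : nat) (q A : BH H) := TX q A /\ pushforward n q A 0.

Definition J (q A : BH H) : BH H := 'i *: bracket A q.

Definition hlift (q A : BH H) : BH H := bracket q (bracket (piX q) A).

(* A field of endomorphisms of the tangent spaces [TX q] is a function
   [I : BH H -> BH H -> BH H], of which only the values [I q A] with [X n q] and
   [TX q A] matter.  Linearity is over the reals only. *)
Definition almost_complex (n : nat) (I : BH H -> BH H -> BH H) :=
  forall q, X n q ->
  [/\ forall A, TX q A -> TX q (I q A),
      forall (r : R) A B, TX q A -> TX q B ->
        I q (r%:C *: A + B) = r%:C *: I q A + I q B
    & forall A, TX q A -> I q (I q A) = - A].

(* The two conditions determine [Jhat] on the tangent spaces of [X n], as [TX q]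
   is the direct sum of the vertical vectors and of the image of [hlift q]. *)
Definition is_Jhat (n : nat) (Jhat : BH H -> BH H -> BH H) :=
  [/\ almost_complex n Jhat,
      forall q A, X n q -> vertical n q A -> Jhat q A = 'i *: A
    & forall q A, X n q -> TG (piX q) A ->
        Jhat q (hlift q A) = hlift q (J (piX q) A)].

End Idempotents.

(* Main.v *)
(* With [p = piX q] and [b = (1 - p) A p], a tangent vector [A] at [q] is the sum
   of [h = hlift q (b + b^* )] and of a vector [V] with [q V = V].  A vector [V]
   with [q V = V] and [V q = 0] is vertical, because
   [q + t V = (1 - t V) q (1 + t V)] is a curve of idempotents with the same
   range and trace as [q].  On such vectors [J = - 'i] and [Jhat = 'i], so both
   [J Jhat] and [Jhat J] are the identity.  On horizontal vectors
   [W = J h - Jhat h] satisfies [q W = W] and [W q = 0], whence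
   [J Jhat h = - h - J W = - h + 'i W = - h + Jhat W = Jhat J h].
   The projection [p] and the adjoint [b^*] come from the Hilbert projection
   theorem. *)
Require Import Defs.
From mathcomp Require Import all_boot all_order all_algebra.
From mathcomp Require Import complex sesquilinear.
From mathcomp Require Import all_classical all_reals all_analysis.
From mathcomp Require Import ring.

Set Implicit Arguments.
Unset Strict Implicit.
Unset Printing Implicit Defensive.

Import Order.TTheory GRing.Theory Num.Theory.
Import numFieldNormedType.Exports.

Local Open Scope ring_scope.
Local Open Scope classical_set_scope.
Local Open Scope complex_scope.

(** * Continuity of linear operators and norm bounds *)

Section BoundedLinear.
Variables (K : numFieldType) (V : normedModType K).

Lemma BH_bounded (A : BH V) : exists2 M, 0 < M & forall x, `|A x| <= M * `|x|.
Proof.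
have /linear_bounded_continuous/linear_boundedP/pinfty_ex_gt0[M M0 AM] :
  continuous A := @BH_continuous _ _ A.
by exists M.
Qed.

Lemma bounded_opI (f : V -> V) M : linear f -> 0 < M ->
  (forall x, `|f x| <= M * `|x|) -> f \in bounded_op (V := V).
Proof.
move=> lf M0 fM; apply/bounded_opP; split=> // x; apply/cvgrPdist_lt => e e0.
have f_sub y z : f (y - z) = f y - f z.
  by rewrite -scaleN1r addrC lf scaleN1r addrC.
near=> y; rewrite -f_sub; apply: (le_lt_trans (fM _)).
rewrite mulrC -ltr_pdivlMr //.
by near: y; apply: cvgr_dist_lt => //; rewrite divr_gt0.
Unshelve. all: by end_near. Qed.

End BoundedLinear.

(** * Cauchy-Schwarz and nearest-point projection *)

Section InnerProduct.
Variables (R : realType) (H : completeNormedModType R[i]).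
Variable ip : {dot H for Num.conj}.
Hypothesis ip_H : ip_norm ip.
Implicit Types (x y z s t : H) (S : set H).

Lemma ipC x y : ip x y = Num.conj (ip y x).
Proof. by rewrite hermC expr0 mul1r. Qed.

Lemma ipZl a x y : ip (a *: x) y = a * ip x y.
Proof. by rewrite linearZl. Qed.

Lemma ipZr a x y : ip x (a *: y) = Num.conj a * ip x y.
Proof. by rewrite linearZr. Qed.

(** Pythagoras: the coefficient of [t] is the one that makes the remainder orthogonal to [t]. *)
Lemma ip_sub_proj z t : t != 0 ->
  `|z - (ip z t / `|t| ^+ 2) *: t| ^+ 2 = `|z| ^+ 2 - `|ip z t| ^+ 2 / `|t| ^+ 2.
Proof.
move=> t0; have nt0 : `|t| ^+ 2 != 0 by rewrite expf_neq0 ?normr_eq0.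
set l := ip z t / _.
have ot : ip (z - l *: t) t = 0.
  by rewrite linearBl /= ipZl -ip_H divfK ?subrr.
rewrite !ip_H linearBr /= ipZr ot mulr0 subr0 linearBl /= ipZl.
by rewrite [ip t z]ipC -mulrA [_^-1 * _]mulrC mulrA -normCK -!ip_H.
Qed.

Lemma ip_le x y : `|ip x y| <= `|x| * `|y|.
Proof.
have [->|y0] := eqVneq y 0; first by rewrite linear0r !normr0 mulr0.
have ny : 0 < `|y| ^+ 2 by rewrite exprn_gt0 ?normr_gt0.
have := exprn_ge0 2 (normr_ge0 (x - (ip x y / `|y| ^+ 2) *: y)).
rewrite ip_sub_proj // subr_ge0 ler_pdivrMr // -exprMn.
by rewrite ler_pXn2r ?nnegrE ?mulr_ge0.
Qed.

(** Moving [s] by the projection of [x - s] on [t] stays in [S] and lowers the squared distance by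
    [|ip (x - s) t|^2 / |t|^2]; near-minimality bounds this gain by [d^2]. *)
Lemma approx_minimizer_orthogonal S x s (d : R[i]) :
  (forall a t, S t -> S (s + a *: t)) -> 0 <= d ->
  (forall t, S t -> `|x - s| ^+ 2 <= `|x - t| ^+ 2 + d ^+ 2) ->
  forall t, S t -> `|ip (x - s) t| <= d * `|t|.
Proof.
move=> Ss d0 smin t St.
have [->|t0] := eqVneq t 0; first by rewrite linear0r !normr0 mulr0.
have nt : 0 < `|t| ^+ 2 by rewrite exprn_gt0 ?normr_gt0.
have := smin _ (Ss (ip (x - s) t / `|t| ^+ 2) _ St).
rewrite opprD addrA ip_sub_proj // -addrA lerDl addrC subr_ge0.
rewrite ler_pdivrMr // -exprMn.
by rewrite ler_pXn2r ?nnegrE ?mulr_ge0.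
Qed.


(** The infimum is taken in [R], where bounded sets have one; squared norms and [d] are real
    elements of [R[i]], so [complex.Re] loses nothing. *)
Lemma approx_minimizer S x (d : R[i]) : S !=set0 -> 0 < d ->
  exists2 s, S s & forall t, S t -> `|x - s| ^+ 2 <= `|x - t| ^+ 2 + d.
Proof.
move=> [s0 Ss0] d0.
pose N s : R := complex.Re (`|x - s| ^+ 2).
have NE s : (N s)%:C = `|x - s| ^+ 2.
  by rewrite RRe_real // ger0_real // exprn_ge0.
have dE : (complex.Re d)%:C = d by rewrite RRe_real // gtr0_real.
have Ninf : has_inf [set N s | s in S].
  split; first by exists (N s0), s0.
  by exists 0 => _ [s _ <-]; rewrite -ler0c NE exprn_ge0.
have d0' : 0 < complex.Re d by rewrite -ltcR dE.
have [_ [s Ss <-] sinf] := inf_adherent d0' Ninf.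
exists s => // t St; rewrite -!NE -dE -rmorphD lecR.
apply: (le_trans (ltW sinf)); rewrite lerD2r.
by apply: ge_inf; [case: Ninf | exists t].
Qed.

Lemma ip_continuousl y : continuous (fun x => ip x y : R[i]^o).
Proof.
move=> l; apply/cvgrPdist_lt => e e0.
have [->|y0] := eqVneq y 0.
  by near=> x; rewrite !linear0r subrr normr0.
have ny : 0 < `|y| by rewrite normr_gt0.
near=> x; have -> : ip l y - ip x y = ip (l - x) y by rewrite linearBl.
apply: (le_lt_trans (ip_le _ _)); rewrite -ltr_pdivlMr // distrC.
by near: x; apply: cvgr_distC_lt => //; rewrite divr_gt0.
Unshelve. all: by end_near. Qed.

(** Near-minimizers of the distance to [x] are nearly orthogonal to [S]. This alone makes them a
    Cauchy sequence, and orthogonality becomes exact in the limit. *)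
Lemma orthogonal_projection_exists S x : closed S -> S 0 ->
  (forall a s t, S s -> S t -> S (s + a *: t)) ->
  exists2 s, S s & forall t, S t -> ip (x - s) t = 0.
Proof.
move=> Scl S0 Slin.
pose d n : R[i] := n.+1%:R^-1.
have d_gt0 n : 0 < d n by rewrite invr_gt0 ltr0Sn.
have /choice[u uP] : forall n, exists s, S s /\
    forall t, S t -> `|ip (x - s) t| <= d n * `|t|.
  move=> n; have [||s Ss smin] := @approx_minimizer S x (d n ^+ 2).
  - by exists 0.
  - by rewrite exprn_gt0.
  exists s; split=> //.
  apply: (@approx_minimizer_orthogonal S x s (d n)) => //; last exact: ltW.
  by move=> a t St; apply: Slin.
have Su n : S (u n) by have [] := uP n.
(* The difference [t] lies in [S], and [|t|^2] is a difference of two pairings of residuals with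
   [t], at most [d n * |t|] and [d m * |t|] in modulus; then divide by [|t|]. *)
have u_cauchy m n : `|u m - u n| <= d m + d n.
  set t := u m - u n.
  have St : S t by rewrite /t -scaleN1r; apply: Slin.
  have [->|t0] := eqVneq t 0; first by rewrite normr0 addr_ge0 // ltW.
  have nt : 0 < `|t| by rewrite normr_gt0.
  rewrite -(ler_pM2r nt) -expr2 mulrDl.
  have -> : `|t| ^+ 2 = `|ip (x - u n) t - ip (x - u m) t|.
    rewrite -linearBl /= opprB addrC addrA subrK -/t -ip_H.
    by rewrite [RHS]ger0_norm // exprn_ge0.
  rewrite [leRHS]addrC; apply: (le_trans (ler_normB _ _)); apply: lerD.
    by have [_] := uP n; apply.
  by have [_] := uP m; apply.
have d_small (e : R[i]) : 0 < e -> \forall n \near \oo, d n < e.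
  move=> e0; have eE : (complex.Re e)%:C = e by rewrite RRe_real // gtr0_real.
  have e0' : 0 < complex.Re e by rewrite -ltcR eE.
  have /cvgrPdist_lt/(_ _ e0') := @cvg_harmonic R.
  apply: filterS => n; rewrite sub0r normrN ger0_norm ?invr_ge0 //= => h.
  by rewrite -eE /d -[_.+1%:R](rmorph_nat (real_complex R)) -fmorphV ltcR.
have /cauchy_cvgP/cvg_ex[l ul] : cauchy (u @ \oo).
  apply/cauchy_ballP => e e0; rewrite near_map2 -ball_normE.
  have e2 : 0 < e / 2 by rewrite divr_gt0.
  exists ([set n | d n < e / 2], [set n | d n < e / 2]).
    by split; exact: d_small.
  move=> [m n] [/= dm dn]; apply: (le_lt_trans (u_cauchy _ _)).
  by rewrite [e]splitr ltrD.
exists l; first by apply: (closed_cvg _ Scl _ _ ul); exact: nearW.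
move=> t St.
have xul : (fun n => x - u n) @ \oo --> x - l.
  by apply: cvgB => //; exact: cvg_cst.
have [->|t0] := eqVneq t 0; first by rewrite linear0r.
have nt : 0 < `|t| by rewrite normr_gt0.
have iul : (fun n => ip (x - u n) t : R[i]^o) @ \oo --> (ip (x - l) t : R[i]^o).
  exact: cvg_comp _ _ xul (@ip_continuousl t (x - l)).
suff i0 : (fun n => ip (x - u n) t : R[i]^o) @ \oo --> (0 : R[i]^o).
  exact: (cvg_unique (@norm_hausdorff _ R[i]^o) iul i0).
apply/cvgrPdist_lt => e e0; have et : 0 < e / `|t| by rewrite divr_gt0.
apply: filterS (d_small _ et) => n dn; rewrite sub0r normrN.
have [_ /(_ _ St) ut] := uP n.
by apply: (le_lt_trans ut); rewrite -ltr_pdivlMr.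
Qed.

(** * Adjoints and orthogonal projections as bounded operators *)

Lemma ip_inj y z : (forall x, ip x y = ip x z) -> y = z.
Proof.
move=> yz; apply/subr0_eq/eqP; rewrite -normr_eq0 -sqrf_eq0 ip_H.
by rewrite linearBr /= yz subrr.
Qed.

(** Riesz representation of the functional [ip (A x) y] of [x]: unless it vanishes, its closed
    kernel [S] has a nonzero orthogonal vector [z], and a multiple of [z] represents it. *)
Lemma adjoint_at (A : BH H) y : exists w, forall x, ip (A x) y = ip x w.
Proof.
have [[x0 fx0]|] := pselect (exists x0, ip (A x0) y != 0); last first.
  move=> A0; exists 0 => x; rewrite linear0r; apply/eqP.
  by apply: contra_notT A0 => Ax; exists x.
pose S := [set x | ip (A x) y = 0].
have Scl : closed S.
  have c0 : closed [set 0 : R[i]^o].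
    by apply/accessible_closed_set1/hausdorff_accessible; exact: norm_hausdorff.
  have /continuous_closedP/(_ _ c0) c1 : continuous (fun x => ip x y : R[i]^o) :=
    @ip_continuousl y.
  have : continuous A := @BH_continuous _ _ A.
  by move=> /continuous_closedP/(_ _ c1).
have [||s Ss xsS] := orthogonal_projection_exists x0 Scl.
- by rewrite /S /= !linear0 linear0l.
- move=> a s t Ss St; rewrite /S /= linearD linearZ linearDl /= ipZl Ss St.
  by rewrite mulr0 addr0.
set z := x0 - s in xsS.
have fz : ip (A z) y = ip (A x0) y by rewrite linearB linearBl /= Ss subr0.
have fz0 : ip (A z) y != 0 by rewrite fz.
have zz0 : ip z z != 0.
  apply: contra_neq fz0; rewrite -ip_H => /eqP; rewrite sqrf_eq0 normr_eq0.
  by move=> /eqP ->; rewrite linear0 linear0l.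
exists (Num.conj (ip (A z) y / ip z z) *: z) => x.
rewrite ipZr conjCK.
(* Subtracting this multiple of [z] from [x] lands in the kernel, to which [z] is orthogonal. *)
have : ip z (x - (ip (A x) y / ip (A z) y) *: z) = 0.
  by apply: xsS; rewrite /S /= linearB linearZ linearBl /= ipZl divfK ?subrr.
move=> /(congr1 Num.conj); rewrite rmorph0 -ipC linearBl /= ipZl => /subr0_eq ->.
by field; rewrite fz0 zz0.
Qed.

(** Uniqueness of the representing vectors gives linearity, and [|f y|^2 = ip (A (f y)) y] gives the
    bound [M] of [A] for [f]. *)
Lemma adjoint_exists (A : BH H) :
  exists B : BH H, forall x y, ip (A x) y = ip x (B y).
Proof.
have /choice[f fP] := adjoint_at A.
have lf : linear f.
  move=> a y z; apply: ip_inj => x.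
  by rewrite linearDr /= ipZr -!fP linearDr /= ipZr.
have [M M0 AM] := BH_bounded A.
have fM y : `|f y| <= M * `|y|.
  have [->|fy0] := eqVneq (f y) 0; first by rewrite normr0 mulr_ge0 // ltW.
  have nf : 0 < `|f y| by rewrite normr_gt0.
  rewrite -(ler_pM2r nf) -expr2.
  have -> : `|f y| ^+ 2 = `|ip (A (f y)) y|.
    by rewrite fP -ip_H [RHS]ger0_norm // exprn_ge0.
  apply: (le_trans (ip_le _ _)).
  by rewrite mulrAC ler_wpM2r.
by exists (MkBH (bounded_opI lf M0 fM)).
Qed.

(** It suffices to construct one projection, since [piX] chooses with [xget]. The range of [q] is
    the kernel of [q - 1], hence closed, so nearest points exist. *)
Lemma piX_orthoproj (q : BH H) : q * q = q ->
  is_orthoproj_onto ip (range q) (piX ip q).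
Proof.
move=> qq; apply: xgetPex.
have qqx x : q (q x) = q x by rewrite -[q (q x)]/((q * q) x) qq.
have rq x : range q x <-> q x = x.
  by split=> [[y _ <-] //|qx]; exists x.
have Scl : closed (range q).
  have c0 : closed [set 0 : H].
    by apply/accessible_closed_set1/hausdorff_accessible; exact: norm_hausdorff.
  have /continuous_closedP/(_ _ c0) : continuous (q - 1 : BH H) :=
    @BH_continuous _ _ _.
  congr closed; apply/seteqP; split=> x /=.
    by move=> /subr0_eq /rq.
  by move=> /rq qx; rewrite -[LHS]/(q x - x) qx subrr.
have /choice[f fP] : forall x, exists s,
    range q s /\ forall t, range q t -> ip (x - s) t = 0.
  move=> x; have [||s ? ?] := orthogonal_projection_exists x Scl.
  - by apply/rq; rewrite linear0.
  - move=> a s t /rq qs /rq qt.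
    by apply/rq; rewrite linearD linearZ /= qs qt.
  by exists s.
(* Uniqueness of the nearest point makes the pointwise choice [f] linear and the identity on the
   range. *)
have f_uniq x s :
    range q s -> (forall t, range q t -> ip (x - s) t = 0) -> f x = s.
  move=> qs xs; have [qfx xfx] := fP x.
  have qfs : range q (f x - s).
    move/rq: qs => qs; move/rq: qfx => qfx.
    by apply/rq; rewrite linearB /= qs qfx.
  apply/subr0_eq/eqP; rewrite -normr_eq0 -sqrf_eq0 ip_H.
  have {1}-> : f x - s = (x - s) - (x - f x) by rewrite opprB [RHS]addrC addrA subrK.
  by rewrite linearBl /= xs // xfx // subrr.
have lf : linear f.
  move=> a x y; have [/rq qx ox] := fP x; have [/rq qy oy] := fP y.
  apply: f_uniq => [|t qt]; first by apply/rq; rewrite linearD linearZ /= qx qy.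
  have -> : a *: x + y - (a *: f x + f y) = a *: (x - f x) + (y - f y).
    by rewrite scalerBr opprD addrACA.
  by rewrite linearDl /= ipZl ox // oy // mulr0 addr0.
have fK x : range q x -> f x = x.
  by move=> qx; apply: f_uniq => // t _; rewrite subrr linear0l.
have f1 x : `|f x| <= 1 * `|x|.
  have [->|fx0] := eqVneq (f x) 0; first by rewrite normr0 mul1r.
  have nf : 0 < `|f x| by rewrite normr_gt0.
  rewrite mul1r -(ler_pM2r nf) -expr2.
  have [qfx ox] := fP x.
  have -> : `|f x| ^+ 2 = `|ip x (f x)|.
    have -> : ip x (f x) = ip (f x) (f x).
      by apply/subr0_eq; rewrite -[RHS](ox _ qfx) linearBl.
    by rewrite -ip_H [RHS]ger0_norm // exprn_ge0.
  exact: ip_le.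
exists (MkBH (bounded_opI lf ltr01 f1)); split.
- by apply: BH_ext => x; apply: fK; have [] := fP x.
- move=> x y /=; have [qx /(_ _ (fP y).1) ox] := fP x.
  have [qy /(_ _ qx) oy] := fP y.
  move: ox (congr1 Num.conj oy); rewrite -ipC rmorph0 linearBl linearBr /=.
  by move=> /subr0_eq -> /subr0_eq.
- apply/seteqP; split=> x /=; first by move=> [y _ <-]; have [] := fP y.
  by move=> /fK <-; exists x.
Qed.

End InnerProduct.

(** Nonnegative elements of [R[i]] are real, so the comparison test is carried over from [R]. It
    serves the summability condition in [has_trace]. *)
Lemma series_le_cvg_complex (R : realType) (a b : nat -> R[i]) (C : R[i]) : 0 < C ->
  (forall k, 0 <= a k) -> (forall k, 0 <= b k <= C * a k) ->
  cvgn (series (a : nat -> R[i]^o)) -> cvgn (series (b : nat -> R[i]^o)).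
Proof.
move=> C0 a0 bC.
have b0 k : 0 <= b k by case/andP: (bC k).
have ReE (z : R[i]) : 0 <= z -> (complex.Re z)%:C = z.
  by move=> z0; rewrite RRe_real // ger0_real.
pose ra k := complex.Re (a k); pose rb k := complex.Re (b k).
have raE k : a k = (ra k)%:C by rewrite ReE.
have rbE k : b k = (rb k)%:C by rewrite ReE.
have normE (x : R) : `|x%:C| = `|x|%:C.
  by rewrite normc_def /= expr0n /= addr0 sqrtr_sqr.
move=> /cvg_cauchy/cauchy_seriesP ca.
have cra : cvgn (series ra).
  apply/cauchy_cvgP/cauchy_seriesP => e e0.
  have e0' : 0 < e%:C by rewrite ltcR.
  apply: filterS (ca _ e0') => -[m n] /=.
  by under eq_bigr do rewrite raE; rewrite -rmorph_sum normE ltcR.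
have vE k : ((complex.Re C *: ra) k)%:C = C * a k.
  by rewrite -[LHS]/((complex.Re C * ra k)%:C) rmorphM /= -raE ReE // ltW.
have crb : cvgn (series rb).
  apply: (series_le_cvg _ _ _ (is_cvg_seriesZ (k := complex.Re C) cra)) => k.
  - by rewrite -lecR -rbE.
  - by rewrite -lecR vE mulr_ge0 // ltW.
  - by rewrite -lecR -rbE vE; case/andP: (bC k).
have /cvg_ex[l /cvgrPdist_lt rbl] := crb.
apply/cvg_ex; exists (l%:C : R[i]^o); apply/cvgrPdist_lt => e e0.
have eE : (complex.Re e)%:C = e by rewrite ReE // ltW.
have e0' : 0 < complex.Re e by rewrite -ltcR eE.
apply: filterS (rbl _ e0') => n.
rewrite -ltcR eE -normE rmorphB /series /= rmorph_sum /=.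
by under eq_bigr do rewrite -rbE.
Qed.

(** * Conjugation invariance of the trace and curves inside a fiber *)

Section Trace.
Variables (R : realType) (H : completeNormedModType R[i]).
Variable ip : {dot H for Num.conj}.
Hypothesis ip_H : ip_norm ip.

(** A nuclear representation [u, v] of [A] becomes [S^* u, T v] for [T A S]; the trace series keeps
    each of its terms, because [S T = 1]. *)
Lemma has_trace_conj (A S T : BH H) t : S * T = 1 -> has_trace ip A t ->
  has_trace ip (T * A * S) t.
Proof.
move=> ST [u [v [uv_cvg A_uv tr_uv]]].
have [S' S'P] := adjoint_exists ip_H S.
exists (S' \o u), (T \o v); split.
- have [M M0 SM] := BH_bounded S'; have [N N0 TN] := BH_bounded T.
  apply: series_le_cvg_complex uv_cvg; first exact: mulr_gt0 M0 N0.
    by move=> k; rewrite mulr_ge0.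
  by move=> k; rewrite mulr_ge0 //= mulrACA ler_pM.
- move=> x; have cT : continuous T := @BH_continuous _ _ T.
  rewrite [X in X @ _](_ : _ = T \o series (fun k => ip (S x) (u k) *: v k)).
    exact: cvg_comp _ _ (A_uv (S x)) (cT (A (S x))).
  apply/funext => m; rewrite /series /= linear_sum; apply: eq_bigr => k _.
  by rewrite linearZ /= S'P.
- rewrite [X in series X](_ : _ = fun k => ip (v k) (u k)) //.
  apply/funext => k /=.
  by rewrite -S'P -[S (T _)]/((S * T) (v k)) ST.
Qed.

Lemma vertical_left_mul (n : nat) (q V : BH H) :
  X ip n q -> q * V = V -> V * q = 0 -> vertical ip n q V.
Proof.
move=> [qq trq] qV Vq; split; first by rewrite /TX qV Vq addr0.
have VV : V * V = 0 by rewrite -{2}qV mulrA Vq mul0r.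
pose c (t : R) := q + t%:C *: V.
have tVtV (t : R) : (t%:C *: V) * (t%:C *: V) = 0.
  by rewrite -BH_scaleAl -BH_scaleAr VV !scaler0.
have qtV (t : R) : q * (t%:C *: V) = t%:C *: V by rewrite -BH_scaleAr qV.
have tVq (t : R) : (t%:C *: V) * q = 0 by rewrite -BH_scaleAl Vq scaler0.
(* Each of [c t] and [q] is a right multiple of the other, so their ranges agree and [piX] is
   constant along the curve. *)
have cE t : c t = q * (1 + t%:C *: V) by rewrite mulrDr mulr1 qtV.
have cK t : q = c t * (1 - t%:C *: V).
  by rewrite mulrDr mulr1 mulrN mulrDl qtV tVtV addr0 addrK.
have c_conj t : c t = (1 - t%:C *: V) * q * (1 + t%:C *: V).
  by rewrite mulrBl mul1r tVq subr0.
have piXc t : piX ip (c t) = piX ip q.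
  rewrite /piX; congr (xget 0 (is_orthoproj_onto _ _)).
  apply/seteqP; split=> _ [x _ <-].
    by exists ((1 + t%:C *: V : BH H) x) => //; rewrite cE.
  by exists ((1 - t%:C *: V : BH H) x) => //; rewrite [in RHS](cK t).
have c0 : c 0 = q by rewrite /c scale0r addr0.
have opnorm0 (e : R) : 0 < e -> opnorm_le (0 : BH H) e%:C.
  move=> e0 x; rewrite [X in `|X| <= _](_ : _ = 0) // normr0.
  by rewrite mulr_ge0 // ler0c ltW.
exists c; split=> //.
- move=> t; split.
    by rewrite /c mulrDl !mulrDr qq qtV tVq tVtV !addr0.
  rewrite c_conj; apply: has_trace_conj trq.
  by rewrite mulrDl mul1r mulrBr mulr1 tVtV subr0 subrK.
(* The curve is affine: for [t != 0] the difference quotient is exactly [V]. *)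
- move=> e e0; near=> t.
  have t0 : t != 0 by near: t; exact: nbhs_dnbhs_neq.
  rewrite c0 /c [q + _]addrC addrK scalerA -rmorphM mulVf // scale1r subrr.
  exact: opnorm0.
- by move=> e e0; near=> t; rewrite /= !piXc subrr scaler0 subr0; exact: opnorm0.
Unshelve. all: by end_near. Qed.

End Trace.

(** * Algebra of tangent vectors at an idempotent *)

Section IdempotentAlgebra.
Variables (R : realType) (H : completeNormedModType R[i]).
Implicit Types (p q b c A V W : BH H).

Lemma JD q A B : J q (A + B) = J q A + J q B.
Proof. by rewrite /J /bracket mulrDl mulrDr opprD addrACA scalerDr. Qed.

Lemma TX_left_mul q V : q * V = V -> TX q V -> V * q = 0.
Proof. by move=> qV; rewrite /TX qV => /(canRL (addKr _)); rewrite addNr. Qed.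

Lemma J_left_mul q V : q * V = V -> V * q = 0 -> J q V = - ('i *: V).
Proof. by move=> qV Vq; rewrite /J /bracket qV Vq sub0r scalerN. Qed.

(** Multiplying [q A + A q = A] by [q] on the left leaves [q A + q A q = q A]. *)
Lemma TX_sandwich q A : q * q = q -> TX q A -> q * A * q = 0.
Proof.
move=> qq /(congr1 (fun B => q * B)); rewrite mulrDr !mulrA qq.
by move=> /(canRL (addKr _)); rewrite addNr.
Qed.

Lemma TX_J q A : q * q = q -> TX q A -> TX q (J q A).
Proof.
move=> qq TA; have qAq := TX_sandwich qq TA.
rewrite /TX /J -BH_scaleAl -BH_scaleAr -scalerDr /bracket mulrBl mulrBr.
by rewrite -!mulrA qq !mulrA qq qAq sub0r subr0 addrC.
Qed.

(** As [q A q = 0], the double bracket of [A] with [q] is [A q + q A = A], and the scalar is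
    ['i^2 = -1]. *)
Lemma JK q A : q * q = q -> TX q A -> J q (J q A) = - A.
Proof.
move=> qq TA; have qAq := TX_sandwich qq TA.
rewrite {1}/J /bracket /J -BH_scaleAl -BH_scaleAr -scalerBr scalerA -expr2 sqr_i.
rewrite /bracket mulrBl mulrBr -!mulrA qq !mulrA qq qAq subr0 sub0r opprK.
by rewrite addrC TA scaleN1r.
Qed.

(* In the splitting of [H] by [p], a tangent vector at [p] has the off-diagonal
   blocks [b] and [c]. *)
Lemma bracket_off_diagonal p q b c : p * q = q -> q * p = p ->
  p * b = 0 -> b * p = b -> p * c = c -> c * p = 0 ->
  bracket q (bracket p (b + c)) = c - q * b + b * q.
Proof.
move=> pq qp pb bp pc cp.
have qc : q * c = c by rewrite -pc mulrA qp.
have cq : c * q = 0 by rewrite -pq mulrA cp mul0r.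
have -> : bracket p (b + c) = c - b.
  by rewrite /bracket mulrDr mulrDl pb bp pc cp add0r addr0.
by rewrite /bracket mulrBr mulrBl qc cq sub0r opprK.
Qed.

End IdempotentAlgebra.

(** * Commutation on the two components of a tangent vector *)

Theorem proposition3p2p18 (R : realType) (H : completeNormedModType R[i])
    (ip : {dot H for Num.conj}) (ip_H : ip_norm ip)
    (n : nat) (Jhat : BH H -> BH H -> BH H) (Jhat_spec : is_Jhat ip n Jhat)
    (q : BH H) (q_X : X ip n q) (A : BH H) (A_TX : TX q A) :
  J q (Jhat q A) = Jhat q (J q A).
Proof.
have [Jhat_ac Jhat_vert Jhat_hor] := Jhat_spec.
have [Jhat_TX Jhat_lin JhatK] := Jhat_ac _ q_X.
have JhatD B C : TX q B -> TX q C -> Jhat q (B + C) = Jhat q B + Jhat q C.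
  by move=> TB TC; have := Jhat_lin 1 _ _ TB TC; rewrite !scale1r.
have [qq _] := q_X.
have [pp p_herm p_range] := piX_orthoproj ip_H qq.
set p := piX ip q in pp p_herm p_range Jhat_hor.
(* Both idempotents fix their common range pointwise. *)
have [pq qp] : p * q = q /\ q * p = p.
  split; apply: BH_ext => x /=.
    have [y _ <-] : range p (q x) by rewrite p_range; exists x.
    by rewrite -[LHS]/((p * p) y) pp.
  have [y _ <-] : range q (p x) by rewrite -p_range; exists x.
  by rewrite -[LHS]/((q * q) y) qq.
(* This block is chosen so that the lift [h] below satisfies [h q = A q]; then [V = A - h] has
   [V q = 0], and tangency gives [q V = V]. *)
pose b := A * p - p * A * p.
have [c bc] := adjoint_exists ip_H b.
have pb : p * b = 0 by rewrite /b mulrBr !mulrA pp subrr.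
have bp : b * p = b by rewrite /b mulrBl -!mulrA pp.
have pc : p * c = c.
  apply: BH_ext => y; apply: (ip_inj ip_H) => x.
  by rewrite /= -p_herm -!bc -[b (p x)]/((b * p) x) bp.
have cp : c * p = 0.
  apply: BH_ext => y; apply: (ip_inj ip_H) => x.
  by rewrite /= -bc -p_herm -[p (b x)]/((p * b) x) pb linear0r linear0l.
have TG_bc : TG ip p (b + c).
  split; last by rewrite mulrDr mulrDl pb bp pc cp add0r addr0 addrC.
  move=> x y /=; rewrite linearDl linearDr /= bc addrC; congr (_ + _).
  by rewrite (ipC ip (c x)) -bc -ipC.
pose h := hlift ip q (b + c).
have hE : h = c - q * b + b * q by exact: bracket_off_diagonal.
have qc : q * c = c by rewrite -pc mulrA qp.
have cq : c * q = 0 by rewrite -pq mulrA cp mul0r.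
have qh : q * h = c - q * b + q * b * q.
  by rewrite hE mulrDr mulrBr !mulrA qq qc.
have hq : h * q = b * q - q * b * q.
  by rewrite hE mulrDl mulrBl cq -!mulrA qq sub0r addrC !mulrA.
have TX_h : TX q h.
  by rewrite /TX qh hq hE [b * q - _]addrC addrA addrK.
have vert W : q * W = W -> W * q = 0 -> vertical ip n q W.
  exact: vertical_left_mul.
pose V := A - h.
have TX_V : TX q V.
  by rewrite /TX /V mulrBr mulrBl addrACA -opprD A_TX TX_h.
have qV : q * V = V.
  have hqE : h * q = A * q.
    have bq : b * q = A * q - p * A * q by rewrite /b mulrBl -!mulrA pq.
    have qbq : q * b * q = - (p * A * q).
      by rewrite -mulrA bq mulrBr !mulrA qp (TX_sandwich qq A_TX) sub0r.
    by rewrite hq qbq bq opprK subrK.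
  by rewrite /V mulrBr -[in RHS]A_TX -[in RHS]TX_h hqE opprD addrACA subrr addr0.
have Vq := TX_left_mul qV TX_V.
pose W := J q h - Jhat q h.
(* On the base [J] sends [b + c] to ['i b - 'i c], which has the same block shape, so the lift
   formula applies again. *)
have Jh'E : Jhat q h = 'i *: (b * q - c - q * b).
  have -> : Jhat q h = hlift ip q ('i *: b + - ('i *: c)).
    rewrite Jhat_hor // /J /bracket mulrDr mulrDl pb bp pc cp addr0 add0r.
    by rewrite scalerBr.
  rewrite /hlift (bracket_off_diagonal pq qp).
  - by rewrite -BH_scaleAl -BH_scaleAr !scalerBr addrC addrA.
  - by rewrite -BH_scaleAr pb scaler0.
  - by rewrite -BH_scaleAl bp.
  - by rewrite mulrN -BH_scaleAr pc.
  - by rewrite mulNr -BH_scaleAl cp scaler0 oppr0.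
have WE : W = 'i *: ((q * b - q * b * q) *+ 2).
  rewrite /W Jh'E /J /bracket qh hq -scalerBr; congr (_ *: _).
  apply/eqP; rewrite subr_eq; apply/eqP; rewrite mulr2n opprD opprB.
  rewrite [LHS](AC (2*3) ((1*4*2)*(3*5))) /=.
  by rewrite [RHS]addrC [RHS]addrA subrKA.
have qW : q * W = W.
  by rewrite WE -BH_scaleAr mulrnAr mulrBr !mulrA qq.
have Wq : W * q = 0.
  by rewrite WE -BH_scaleAl mulrnAl mulrBl -!mulrA qq subrr mul0rn scaler0.
have TX_W : TX q W by have [] := vert _ qW Wq.
have TX_Jh : TX q (Jhat q h) by exact: Jhat_TX.
have JhE : J q h = Jhat q h + W by rewrite addrC subrK.
have ii (B : BH H) : 'i *: ('i *: B) = - B.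
  by rewrite scalerA -expr2 sqr_i scaleN1r.
(* [Jhat] is only real-linear, so its value at [J q V = - 'i V] comes from the verticality of that
   vector. *)
have q_iV : q * (- ('i *: V)) = - ('i *: V) by rewrite mulrN -BH_scaleAr qV.
have iV_q : - ('i *: V) * q = 0 by rewrite mulNr -BH_scaleAl Vq scaler0 oppr0.
have JJhat_h : J q (Jhat q h) = - h + 'i *: W.
  have := JK qq TX_h; rewrite JhE JD (J_left_mul qW Wq) => /eqP.
  by rewrite subr_eq => /eqP.
have JhatJ_h : Jhat q (J q h) = - h + 'i *: W.
  by rewrite JhE JhatD // JhatK // Jhat_vert //; exact: vert.
have JJhat_V : J q (Jhat q V) = V.
  rewrite Jhat_vert //; last exact: vert.
  by rewrite J_left_mul ?ii ?opprK // -?BH_scaleAr -?BH_scaleAl ?qV ?Vq ?scaler0.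
have JhatJ_V : Jhat q (J q V) = V.
  rewrite J_left_mul // Jhat_vert //; last exact: vert.
  by rewrite scalerN ii opprK.
rewrite -(subrK h A : V + h = A) (JhatD _ _ TX_V TX_h) (JD q V) (JD q (Jhat q V)).
rewrite (JhatD _ _ (TX_J qq TX_V) (TX_J qq TX_h)).
by rewrite JJhat_V JhatJ_V JJhat_h JhatJ_h.
Qed.
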